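(* Let $k\ge 2$, let $V\subseteq\mathbb{R}^k$ be a totally irrational subspace of dimension $d=k-1$, and let $x\in\mathbb{R}^k$. If the window $\mathcal{S}$ is a (nonempty) finite disjoint union of special intervals for $V$, then $Y_{\mathcal{S},x}$ is bounded displacement equivalent to a lattice in $V\cong\mathbb{R}^d$.
   Context: Bounded displacement. Two separated nets $Y,Y'$ in $\mathbb{R}^d$ are bounded displacement equivalent (BD) if there is a bijection $f:Y\to Y'$ with $\sup_{y\in Y}|f(y)-y|<\infty$. (A separated net is a uniformly discrete, relatively dense set.) Cut-and-project sets. Let $\pi:\mathbb{R}^k\to\mathbb{R}^k/\mathbb{Z}^k$ be the canonical projection. A subspace $V$ is totally irrational if $\pi(V)$ is dense in $\mathbb{R}^k/\mathbb{Z}^k$. For $\mathcal{S}\subseteq\mathbb{R}^k/\mathbb{Z}^k$ (the window, or section) and $x\in\mathbb{R}^k$, put \[Y_{\mathcal{S},x}=\{v\in V:\pi(v+x)\in\mathcal{S}\}.\] Coordinates. With $\dim V=k-1$, the coordinates of $\mathbb{R}^k$ are ordered so that the $k$-th standard basis vector $e_k$ is not in $V$; then $V=\{(y_1,\ldots,y_{k-1},\sum_{i=1}^{k-1}y_i\alpha_i):y_i\in\mathbb{R}\}$ for unique $\alpha_1,\ldots,\alpha_{k-1}\in\mathbb{R}$. Total irrationality implies that at least one $\alpha_i$ is irrational, and the coordinates are ordered so that $\alpha_1$ is irrational. This ordering is fixed as part of the data of $V$. Windows are taken in the image of the line spanned by $e_k$: a set $\mathcal{I}\subseteq\mathbb{R}/\mathbb{Z}$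 is identified with the window $\mathcal{S}=\{\pi(te_k):t\in\mathbb{R},\ t\bmod 1\in\mathcal{I}\}$. ''$\mathcal{S}$ is a special interval for $V$'', or a disjoint union of such, means that the corresponding $\mathcal{I}$ is a special interval for $\alpha=\{\alpha_1\}$ (the fractional part of $\alpha_1$), respectively a disjoint union of such, as defined next. Special intervals. Let $\alpha\in(0,1)$ be irrational with simple continued fraction $\alpha=[0;a_1,a_2,\ldots]$ and let $q_k$ ($k\ge0$) be the denominators of its convergents in lowest terms ($q_0=1$, $q_1=a_1$, $q_{k+1}=a_{k+1}q_k+q_{k-1}$). Every non-negative integer $n$ has a unique Ostrowski expansion $n=\sum_{k=0}^\infty c_{k+1}q_k$ with integers $c_{k+1}$, only finitely many nonzero, such that $0\le c_1<a_1$, $0\le c_{k+1}\le a_{k+1}$ for $k\ge1$, and $c_k=0$ whenever $c_{k+1}=a_{k+1}$ for some $k\ge1$. For an integer $m\ge1$ let $\mathcal{A}(m)$ be the set of integers $n\ge0$ whose Ostrowski expansion has the form $n=\sum_{k=m}^\infty c_{k+1}q_k$ (so $0\in\mathcal{A}(m)$). For $\gamma\in\mathbb{R}/\mathbb{Z}$ put $\mathcal{J}(m,\gamma)=\gamma+\overline{\{n\alpha:n\in\mathcal{A}(m)\}}\subseteq\mathbb{R}/\mathbb{Z}$ (closure in $\mathbb{R}/\mathbb{Z}$). The sets $\mathcal{J}(m,\gamma)$, which are intervals in $\mathbb{R}/\mathbb{Z}$, are the special intervals for $\alpha$. *)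

(* Defs.v *)
From HB Require Import structures.
From mathcomp Require Import all_boot all_order all_algebra.
From mathcomp Require Import all_classical all_reals all_analysis.

Set Implicit Arguments.
Unset Strict Implicit.
Unset Printing Implicit Defensive.

Import Order.TTheory GRing.Theory Num.Theory.
Import numFieldNormedType.Exports.

Local Open Scope classical_set_scope.
Local Open Scope ring_scope.
Local Open Scope quotient_scope.

(** * The quotients R / Z and R^k / Z^k, as groups and as topological spaces *)

Definition Zpred (R : realType) : pred R := fun t => t \is a Num.int.

Lemma Zpred_zmod_closed (R : realType) : zmod_closed (@Zpred R).
Proof. exact: GRing.subring_closedB (@int_num_subring R). Qed.

HB.instance Definition _ (R : realType) :=
  GRing.isZmodClosed.Build R (@Zpred R) (@Zpred_zmod_closed R).

Definition Zkpred (R : realType) (k : nat) : pred 'rV[R]_k :=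
  fun v => v \is a mxOver Num.int.

Lemma Zkpred_zmod_closed (R : realType) (k : nat) : zmod_closed (@Zkpred R k).
Proof.
split=> [|u v /mxOverP uZ /mxOverP vZ]; first exact/mxOver0/int_num0.
by apply/mxOverP => i j; rewrite !mxE rpredB.
Qed.

HB.instance Definition _ (R : realType) (k : nat) :=
  GRing.isZmodClosed.Build 'rV[R]_k (@Zkpred R k) (@Zkpred_zmod_closed R k).

Definition circle (R : realType) : Type :=
  quotient_topology (Quotient.quot (GRing.ZmodClosed.clone R (@Zpred R) _)).

HB.instance Definition _ (R : realType) := Topological.on (circle R).
HB.instance Definition _ (R : realType) := Quotient.on (circle R).
HB.instance Definition _ (R : realType) :=
  GRing.Zmodule.copy (circle R)
    (Quotient.quot (GRing.ZmodClosed.clone R (@Zpred R) _)).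

Definition torus (R : realType) (k : nat) : Type :=
  quotient_topology
    (Quotient.quot (GRing.ZmodClosed.clone 'rV[R]_k (@Zkpred R k) _)).

HB.instance Definition _ (R : realType) (k : nat) :=
  Topological.on (torus R k).
HB.instance Definition _ (R : realType) (k : nat) := Quotient.on (torus R k).

(** * Bounded displacement and lattices in a subspace V of R^k *)

Definition uniformly_discrete (R : realType) (k : nat) (Y : set 'rV[R]_k) :=
  exists2 r : R, 0 < r &
    forall y y', Y y -> Y y' -> y != y' -> r <= `|y - y'|.

Definition relatively_dense (R : realType) (k : nat) (V : {vspace 'rV[R]_k})
    (Y : set 'rV[R]_k) :=
  exists r : R, forall v, v \in V -> exists2 y, Y y & `|v - y| <= r.

Definition separated_net (R : realType) (k : nat) (V : {vspace 'rV[R]_k})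
    (Y : set 'rV[R]_k) :=
  [/\ Y `<=` [set` V], uniformly_discrete Y & relatively_dense V Y].

(* The norm is the maximum norm of the coordinates in R^k; since all norms on V
   are equivalent, the choice of a norm (or of an identification of V with R^d)
   is immaterial. *)
Definition BD_equivalent (R : realType) (k : nat) (V : {vspace 'rV[R]_k})
    (Y Y' : set 'rV[R]_k) :=
  [/\ separated_net V Y, separated_net V Y' &
    exists2 f : 'rV[R]_k -> 'rV[R]_k,
      set_bij Y Y' f & has_ubound [set `|f y - y| | y in Y]].

Definition lattice_in (R : realType) (k : nat) (V : {vspace 'rV[R]_k})
    (L : set 'rV[R]_k) :=
  exists2 b : (\dim V).-tuple 'rV[R]_k, basis_of V b &
    L = [set \sum_(i < \dim V) b`_i *~ z i | z in [set: 'I_(\dim V) -> int]].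

(** * Cut-and-project sets *)

Definition totally_irrational (R : realType) (k : nat) (V : {vspace 'rV[R]_k}) :=
  dense ([set \pi_(torus R k) v | v in [set` V]]).

Definition cut_and_project (R : realType) (k : nat) (V : {vspace 'rV[R]_k})
    (S : set (torus R k)) (x : 'rV[R]_k) : set 'rV[R]_k :=
  [set v | v \in V /\ S (\pi_(torus R k) (v + x))].

Definition e_last (R : realType) (k : nat) : 'rV[R]_k.+1 := delta_mx 0 ord_max.

(* [lift ord_max i] is the i-th coordinate among the first k of k.+1. *)
Definition slopes (R : realType) (k : nat) (V : {vspace 'rV[R]_k.+1})
    (alpha : 'rV[R]_k) :=
  forall v, v \in V <->
    v 0 ord_max = \sum_(i < k) v 0 (lift ord_max i) * alpha 0 i.

Definition window (R : realType) (k : nat) (I : set (circle R)) :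
    set (torus R k.+1) :=
  [set \pi_(torus R k.+1) (t *: e_last R k) | t in [set t | I (\pi_(circle R) t)]].

(** * Continued fractions and special intervals *)

Definition fractional_part (R : realType) (t : R) : R := t - (Num.floor t)%:~R.

(* Complete quotients: the i-th one is [a_i; a_(i+1), ...]. *)
Fixpoint cf_rem (R : realType) (alpha : R) (i : nat) : R :=
  if i is j.+1 then (fractional_part (cf_rem alpha j))^-1 else alpha.

Definition cf_digit (R : realType) (alpha : R) (i : nat) : nat :=
  Num.truncn (cf_rem alpha i).

Fixpoint cf_den (R : realType) (alpha : R) (k : nat) : nat :=
  match k with
  | 0 => 1
  | k1.+1 =>
      match k1 with
      | 0 => cf_digit alpha 1
      | k2.+1 => cf_digit alpha k * cf_den alpha k1 + cf_den alpha k2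
      end
  end%N.

(* The digits are c 1, c 2, ...; the value c 0 plays no role. *)
Definition ostrowski (R : realType) (alpha : R) (c : nat -> nat) (n : nat) :=
  [/\ (c 1 < cf_digit alpha 1)%N,
      forall k, (1 <= k)%N -> (c k.+1 <= cf_digit alpha k.+1)%N,
      forall k, (1 <= k)%N -> c k.+1 = cf_digit alpha k.+1 -> c k = 0%N &
      exists2 N : nat, forall k, (N <= k)%N -> c k.+1 = 0%N &
        n = (\sum_(0 <= k < N) c k.+1 * cf_den alpha k)%N].

Definition ostrowski_from (R : realType) (alpha : R) (m : nat) : set nat :=
  [set n | exists2 c, ostrowski alpha c n &
                      forall k, (k < m)%N -> c k.+1 = 0%N].

Definition special_J (R : realType) (alpha : R) (m : nat) (gamma : circle R) :
    set (circle R) :=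
  [set gamma + t | t in
    closure [set \pi_(circle R) (n%:R * alpha) | n in ostrowski_from alpha m]].

Definition special_interval (R : realType) (alpha : R) (I : set (circle R)) :=
  exists2 m : nat, (1 <= m)%N & exists gamma, I = special_J alpha m gamma.

Definition special_union (R : realType) (alpha : R) (I : set (circle R)) :=
  exists N (J : 'I_N -> set (circle R)),
    [/\ forall i, special_interval alpha (J i), trivIset setT J &
        I = \bigcup_i J i].

(* Main.v *)
(* The points of V over a fixed choice of all integer coordinates but the first
   form a row, indexed by the integers m with [m alpha_1 + c] in I mod 1, where c
   depends on the row. Let [d_k = |q_k alpha - p_k|], where p_k / q_k is the
   k-th convergent. By greedy Ostrowski expansion, J(m, gamma) is the closed arc of length
   [d_(m-1) + d_m] with endpoints [gamma - q_(m-1) alpha] and [gamma - q_m alpha].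
   As the endpoints differ by a multiple of alpha mod 1, the visits to such an arc
   have discrepancy bounded uniformly in c (Hecke, Kesten). Hence counting the points
   of each row moves it, by a uniformly bounded amount, onto a progression whose
   step is the inverse of the total length of I. *)

Require Import Defs.
From HB Require Import structures.
From mathcomp Require Import all_boot all_order all_algebra.
From mathcomp Require Import all_classical all_reals all_analysis.
From mathcomp Require Import zify ring lra.

Set Implicit Arguments.
Unset Strict Implicit.
Unset Printing Implicit Defensive.

Import Order.TTheory GRing.Theory Num.Theory.
Import numFieldNormedType.Exports.

Local Open Scope classical_set_scope.
Local Open Scope ring_scope.
Local Open Scope quotient_scope.

(** * Continued fractions *)

Lemma fractional_part_itv (R : realType) (t : R) :
  0 <= fractional_part t < 1.
Proof.
have /andP[] := floor_itv t; rewrite /fractional_part intrD => ? ?.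
by rewrite subr_ge0 ltrBlDl; apply/andP.
Qed.

Lemma irrational_fractional_part (R : realType) (t : R) :
  irrational t -> irrational (fractional_part t).
Proof.
move=> ti [q _ qE]; apply: ti; exists (q + (Num.floor t)%:~R) => //.
by rewrite rmorphD /= ratr_int qE /fractional_part subrK.
Qed.

Lemma irrational_inv (R : realType) (t : R) : irrational t -> irrational t^-1.
Proof.
move=> ti [q _ qE]; apply: ti; exists q^-1 => //.
by rewrite fmorphV /= qE invrK.
Qed.

Lemma irrational_neq0 (R : realType) (t : R) : irrational t -> t != 0.
Proof. by move=> ti; apply/eqP => t0; apply: ti; exists 0; rewrite // t0 rmorph0. Qed.

(** The orbit of the fractional part of [alpha] under the Gauss map. *)
Definition cf_frac (R : realType) (alpha : R) (k : nat) : R :=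
  fractional_part (cf_rem alpha k).

(* [cf_err alpha k.+1] is [|q_k alpha - p_k|]; the shift makes room for the value
   1 at index [k = -1]. *)
Definition cf_err (R : realType) (alpha : R) (k : nat) : R :=
  \prod_(i < k) cf_frac alpha i.

(** Working with real representatives keeps arc computations within linear arithmetic;
    [pi_circle_eq] translates back to the circle. *)
Definition cong1 (R : realType) (s t : R) := s - t \is a Num.int.

Lemma irrational_cf_rem (R : realType) (alpha : R) k :
  irrational alpha -> irrational (cf_rem alpha k).
Proof.
move=> ai; elim: k => //= k IH.
exact/irrational_inv/irrational_fractional_part.
Qed.

Lemma cf_frac_itv (R : realType) (alpha : R) k :
  irrational alpha -> 0 < cf_frac alpha k < 1.
Proof.
move=> ai; have /andP[f0 ->] := fractional_part_itv (cf_rem alpha k).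
by rewrite lt0r f0 irrational_neq0 //; apply/irrational_fractional_part/irrational_cf_rem.
Qed.

Lemma cf_digit_frac (R : realType) (alpha : R) k : irrational alpha ->
  (cf_frac alpha k)^-1 = (cf_digit alpha k.+1)%:R + cf_frac alpha k.+1.
Proof.
move=> ai; rewrite /cf_digit /cf_frac /=.
have /andP[f0 _] := cf_frac_itv k ai.
(* [truncn] agrees with the floor on nonnegative reals only, hence the sign condition. *)
rewrite truncn_floor invr_ge0 ltW //.
by rewrite natr_absz ger0_norm ?floor_ge0 ?invr_ge0 ?ltW // subrKC.
Qed.

Lemma cf_digit_gt0 (R : realType) (alpha : R) k : irrational alpha ->
  (0 < cf_digit alpha k.+1)%N.
Proof.
move=> ai; have /andP[f0 f1] := cf_frac_itv k ai.
by rewrite /cf_digit truncn_gt0 /= invf_ge1 // ltW.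
Qed.

Lemma cf_err0 (R : realType) (alpha : R) : cf_err alpha 0 = 1.
Proof. by rewrite /cf_err big_ord0. Qed.

Lemma cf_errS (R : realType) (alpha : R) k :
  cf_err alpha k.+1 = cf_err alpha k * cf_frac alpha k.
Proof. by rewrite /cf_err big_ord_recr. Qed.

Lemma cf_err_gt0 (R : realType) (alpha : R) k :
  irrational alpha -> 0 < cf_err alpha k.
Proof.
move=> ai; elim: k => [|k IH]; first by rewrite cf_err0.
by rewrite cf_errS mulr_gt0 //; have /andP[] := cf_frac_itv k ai.
Qed.

(** A step d_(k-1) = a_(k+1) d_k + d_(k+1) of the Euclidean algorithm: multiply [cf_digit_frac] by
    [cf_err alpha k.+1]. *)
Lemma cf_errSS (R : realType) (alpha : R) k : irrational alpha ->
  cf_err alpha k = (cf_digit alpha k.+1)%:R * cf_err alpha k.+1 + cf_err alpha k.+2.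
Proof.
move=> ai; rewrite !(cf_errS _ k.+1) [_ * cf_err _ _]mulrC -mulrDr -cf_digit_frac //.
by rewrite cf_errS mulfK //; have /andP[/lt0r_neq0] := cf_frac_itv k ai.
Qed.

Lemma cf_err_dec (R : realType) (alpha : R) k : irrational alpha ->
  cf_err alpha k.+1 <= cf_err alpha k.
Proof.
move=> ai; rewrite cf_errS ler_piMr ?ltW ?cf_err_gt0 //.
by have /andP[] := cf_frac_itv k ai.
Qed.

(** Digits are at least 1 and errors decrease, so by [cf_errSS] the error at least halves every two
    steps. *)
Lemma cf_err_small (R : realType) (alpha : R) (e : R) : irrational alpha ->
  0 < e -> exists K, forall k, (K <= k)%N -> cf_err alpha k < e.
Proof.
move=> ai e0.
have half k : cf_err alpha k.*2 * 2 ^+ k <= 1.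
  elim: k => [|k IH]; first by rewrite cf_err0 expr0 mulr1.
  apply: le_trans IH; rewrite doubleS exprS mulrA ler_pM2r ?exprn_gt0 //.
  rewrite (cf_errSS k.*2 ai).
  have : cf_err alpha k.*2.+1 <= (cf_digit alpha k.*2.+1)%:R * cf_err alpha k.*2.+1.
    by apply: ler_peMl; [exact: ltW (cf_err_gt0 _ ai)|rewrite ler1n cf_digit_gt0].
  by have := cf_err_dec k.*2.+1 ai; lra.
have [m mP] : exists m, e^-1 < 2 ^+ m :> R.
  by exists (Num.bound e^-1); apply: upper_nthrootP.
exists m.*2 => k mk.
have : cf_err alpha k <= cf_err alpha m.*2.
  by apply: (nonincreasing_seqP (cf_err alpha)).1 mk => j; apply: cf_err_dec.
move=> /le_lt_trans; apply.
have p0 : 0 < 2 ^+ m :> R by rewrite exprn_gt0.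
rewrite -(ltr_pM2r p0).
by apply: (le_lt_trans (half m)); rewrite -ltr_pdivrMl // mulr1.
Qed.

(** * Congruence modulo 1 and the convergents *)

Lemma cong1_refl (R : realType) (s : R) : cong1 s s.
Proof. by rewrite /cong1 subrr int_num0. Qed.

Lemma cong1_sym (R : realType) (s t : R) : cong1 s t -> cong1 t s.
Proof. by rewrite /cong1 -rpredN opprB. Qed.

Lemma cong1_trans (R : realType) (s t u : R) : cong1 s t -> cong1 t u -> cong1 s u.
Proof. by rewrite /cong1 => st tu; have := rpredD st tu; rewrite addrA subrK. Qed.

Lemma cong1D (R : realType) (s t s' t' : R) :
  cong1 s t -> cong1 s' t' -> cong1 (s + s') (t + t').
Proof. by rewrite /cong1 opprD addrACA => *; apply: rpredD. Qed.

Lemma cong1N (R : realType) (s t : R) : cong1 s t -> cong1 (- s) (- t).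
Proof. by rewrite /cong1 -opprD rpredN. Qed.

Lemma cong1Mn (R : realType) (n : nat) (s t : R) :
  cong1 s t -> cong1 (n%:R * s) (n%:R * t).
Proof. by rewrite /cong1 -mulrBr => ?; rewrite rpredM // rpred_nat. Qed.

(** The alternating sign turns [cf_errSS] into the recurrence of the denominators, so both sides
    obey the same recurrence modulo 1 and the numerators never appear. *)
Lemma cf_den_err (R : realType) (alpha : R) k : irrational alpha ->
  0 < alpha < 1 ->
  cong1 ((cf_den alpha k)%:R * alpha) ((-1) ^+ k * cf_err alpha k.+1).
Proof.
move=> ai a01.
have frac0 : cf_err alpha 1 = alpha.
  rewrite cf_errS cf_err0 mul1r /cf_frac /= /fractional_part.
  suff -> : Num.floor alpha = 0 by rewrite subr0.
  by apply/floor_def; rewrite add0r; case/andP: a01 => /ltW -> ->.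
(* The recurrence has order two, so the induction carries two consecutive indices. *)
suff H : cong1 ((cf_den alpha k)%:R * alpha) ((-1) ^+ k * cf_err alpha k.+1) /\
  cong1 ((cf_den alpha k.+1)%:R * alpha) ((-1) ^+ k.+1 * cf_err alpha k.+2).
  by case: H.
elim: k => [|k [IH1 IH2]].
  rewrite expr0 !mul1r frac0 expr1; split; first exact: cong1_refl.
  have := cf_errSS 0 ai; rewrite frac0 cf_err0 /= => h.
  by rewrite /cong1 mulN1r opprK -h rpred1.
split=> //.
have -> : (cf_den alpha k.+2)%:R =
    (cf_digit alpha k.+2)%:R * (cf_den alpha k.+1)%:R + (cf_den alpha k)%:R :> R.
  by rewrite -natrM -natrD.
rewrite mulrDl -mulrA.
have -> : (-1) ^+ k.+2 * cf_err alpha k.+3 =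
   (cf_digit alpha k.+2)%:R * ((-1) ^+ k.+1 * cf_err alpha k.+2) +
   (-1) ^+ k * cf_err alpha k.+1.
  by rewrite (cf_errSS k.+1 ai) !exprS; ring.
by apply: cong1D => //; apply: cong1Mn.
Qed.

(** * Special intervals are arcs *)

Lemma pi_circle_eq (R : realType) (s t : R) :
  \pi_(circle R) s = \pi_(circle R) t <-> cong1 s t.
Proof.
have := Quotient.idealrBE (GRing.ZmodClosed.clone R (@Zpred R) _) s t.
rewrite /cong1 unfold_in /Zpred => ->.
by split=> [->|/eqP].
Qed.

Lemma pi_circleD (R : realType) (s t : R) :
  \pi_(circle R) (s + t) = \pi_(circle R) s + \pi_(circle R) t.
Proof.
exact: (raddfD (\pi_(Quotient.quot (GRing.ZmodClosed.clone R (@Zpred R) _)))).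
Qed.

Lemma pi_circle_surj (R : realType) (g : circle R) : exists t, g = \pi_(circle R) t.
Proof. by exists (repr g); rewrite reprK. Qed.

Lemma open_circle (R : realType) (U : set (circle R)) :
  open ((fun t : R => \pi_(circle R) t) @^-1` U) -> open U.
Proof. by []. Qed.

(** The complement pulls back to the integer translates of the open gap from [hi] to [lo + 1], empty
    when [hi = lo + 1]. *)
Lemma closed_circle_arc (R : realType) (lo hi : R) : lo <= hi -> hi <= lo + 1 ->
  closed [set \pi_(circle R) t | t in `[lo, hi]].
Proof.
move=> lohi hilo; rewrite -openC; apply: open_circle.
rewrite (_ : _ @^-1` _ = \bigcup_(z in [set: int]) `]hi + z%:~R, lo + 1 + z%:~R[%classic).
  by apply: bigcup_open => z _; exact: interval_open.
apply/seteqP; split=> t /=.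
  move=> tN; exists (Num.floor (t - lo)) => //=.
  have /andP[zl zh] := floor_itv (t - lo).
  rewrite intrD in zh.
  rewrite in_itv /= ltNge; apply/andP; split; last by lra.
  apply/negP => tz; apply: tN; exists (t - (Num.floor (t - lo))%:~R).
    by rewrite /= in_itv /=; lra.
  by apply/pi_circle_eq; rewrite /cong1 addrAC subrr add0r rpredN intr_int.
move=> [z _] /=; rewrite in_itv /= => /andP[zl zh] [s].
rewrite /= in_itv /= => /andP[sl sh] /pi_circle_eq /intrP[w wE].
(* The integer [w = s - t] would lie strictly between [- z - 1] and [- z]. *)
have w1 : (w : int) < - z.
  rewrite -(ltr_int R) rmorphN /= -wE; lra.
have w2 : - z - 1 < w.
  rewrite -(ltr_int R) rmorphB rmorphN /= -wE; lra.
lia.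
Qed.

(** The sum of (-1)^(j-k) c_(j+1) d_j over k <= j < k+L. Starting with a plus sign makes its range
    independent of the parity of k. *)
Fixpoint alt_sum (R : realType) (alpha : R) (c : nat -> nat) (k L : nat) : R :=
  if L is L'.+1 then (c k.+1)%:R * cf_err alpha k.+1 - alt_sum alpha c k.+1 L'
  else 0.

Lemma alt_sumE (R : realType) (alpha : R) c k L :
  \sum_(k <= j < k + L) (c j.+1)%:R * ((-1) ^+ j * cf_err alpha j.+1) =
  (-1) ^+ k * alt_sum alpha c k L.
Proof.
elim: L k => [|L IH] k; first by rewrite addn0 big_geq // mulr0.
rewrite big_ltn ?addnS ?ltnS ?leq_addr // -addSn IH /= exprS; ring.
Qed.

Lemma eq_alt_sum (R : realType) (alpha : R) c c' k L :
  (forall j, (k <= j)%N -> c j.+1 = c' j.+1) ->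
  alt_sum alpha c k L = alt_sum alpha c' k L.
Proof.
elim: L k => //= L IH k cc'; rewrite cc' // (IH k.+1) // => j kj.
by apply: cc'; apply: ltnW.
Qed.

(** The interval [-d_k, d_(k-1)] reproduces itself: for 0 <= c <= a_(k+1), subtracting a value in
    [-d_(k+1), d_k] from c d_k gives at least -d_k and at most a_(k+1) d_k + d_(k+1) = d_(k-1). *)
Lemma alt_sum_itv (R : realType) (alpha : R) c k L : irrational alpha ->
  (forall j, (k <= j)%N -> (c j.+1 <= cf_digit alpha j.+1)%N) ->
  - cf_err alpha k.+1 <= alt_sum alpha c k L <= cf_err alpha k.
Proof.
move=> ai; have e0 j := ltW (cf_err_gt0 j ai).
elim: L k => [|L IH] k ca /=; first by rewrite oppr_le0 !e0.
have /andP[l u] : - cf_err alpha k.+2 <= alt_sum alpha c k.+1 L <= cf_err alpha k.+1.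
  by apply: IH => j kj; apply/ca/ltnW.
have c0 : 0 <= (c k.+1)%:R * cf_err alpha k.+1 by rewrite mulr_ge0.
have : (c k.+1)%:R * cf_err alpha k.+1 <= (cf_digit alpha k.+1)%:R * cf_err alpha k.+1.
  by rewrite ler_wpM2r // ler_nat ca.
have := cf_errSS k ai.
lra.
Qed.

(* Greedy expansion: the flag [r] records that the previous digit is nonzero,
   so that the first digit may not be maximal. *)
Lemma alt_sum_greedy (R : realType) (alpha : R) (L k : nat) (r : bool) (u : R) :
  irrational alpha ->
  - cf_err alpha k.+1 <= u ->
  u <= cf_err alpha k - (if r then cf_err alpha k.+1 else 0) ->
  exists c : nat -> nat,
    [/\ forall j, (c j.+1 <= cf_digit alpha j.+1)%N,
        forall j, c j.+1 = cf_digit alpha j.+1 -> (0 < j)%N -> c j = 0%N,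
        forall j, (j < k)%N || (k + L <= j)%N -> c j.+1 = 0%N,
        r -> (c k.+1 < cf_digit alpha k.+1)%N &
        `|u - alt_sum alpha c k L| <= cf_err alpha (k + L)].
Proof.
move=> ai; have e0 j := cf_err_gt0 j ai.
have a0 j : (0 < cf_digit alpha j.+1)%N by apply: cf_digit_gt0.
elim: L k r u => [|L IH] k r u ul uu.
  exists (fun=> 0%N); split=> //.
  rewrite addn0 subr0 ler_norml; have := cf_err_dec k ai.
  have := e0 k.+1; move: uu; case: ifP => _; lra.
have errE := cf_errSS k ai; have e2 := e0 k.+2; have e1 := e0 k.+1.
(* The first digit [c0] is the least c for which the remainder c d_k - u respects its lower bound
   -d_(k+1). *)
pose P (c : nat) := u <= c%:R * cf_err alpha k.+1 + cf_err alpha k.+2.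
have Pa : P (cf_digit alpha k.+1).
  rewrite /P -errE; apply: (le_trans uu); rewrite gerBl.
  by case: (r) => //; apply: ltW.
(* Under the flag, u <= d_(k-1) - d_k = (a_(k+1) - 1) d_k + d_(k+1), so a non-maximal digit is
   available. *)
have Pr : r -> P (cf_digit alpha k.+1).-1.
  move=> rT; move: uu; rewrite /P rT errE -(prednK (a0 k)) /= -natr1; lra.
have exP : exists c, P c by exists (cf_digit alpha k.+1).
case: (ex_minnP exP) => c0 Pc0 c0_min.
pose u' := c0%:R * cf_err alpha k.+1 - u.
have ul' : - cf_err alpha k.+2 <= u' by move: Pc0; rewrite /u' /P; lra.
(* If [c0] is positive, minimality says that [c0 - 1] fails, which is exactly the sharper bound that
   the flag demands at the next digit. *)
have uu' : u' <= cf_err alpha k.+1 - (if (0 < c0)%N then cf_err alpha k.+2 else 0).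
  rewrite /u'; case: posnP => [->|c0p]; first by lra.
  have /negP : ~ P c0.-1 by move=> /c0_min; rewrite leqNgt ltn_predL c0p.
  rewrite -ltNge -(prednK c0p) -natr1 /=; lra.
have [c [ca cM cz cr cu]] := IH k.+1 (0 < c0)%N u' ul' uu'.
exists (fun j => if j == k.+1 then c0 else c j); split.
- by move=> j; case: eqP => [[->]|_] //; apply: c0_min.
- move=> j; rewrite eqSS; case: eqP => [->|_] h j0.
    by rewrite ltn_eqF //; case: (k) cz j0 => // k' cz _; apply: cz; rewrite ltnW.
  (* At the junction, a maximal digit after [c0] contradicts [cr] unless [c0] is zero. *)
  case: eqP => jk; last exact: cM.
  move: h cr; rewrite jk => ->; rewrite ltnn; case: posnP => // _ /(_ isT) //.
- move=> j hj; rewrite eqSS; case: eqP => [jk|jk].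
    by move: hj; rewrite jk ltnn /= leqNgt addnS ltnS leq_addr.
  apply: cz; move: hj jk; clear; lia.
- rewrite eqxx => rT; rewrite -(prednK (a0 k)) ltnS; exact/c0_min/Pr.
rewrite /= eqxx addnS -addSn.
rewrite (_ : alt_sum _ _ _ _ = alt_sum alpha c k.+1 L); last first.
  by apply: eq_alt_sum => j kj; rewrite eqSS gtn_eqF.
rewrite (_ : u - _ = - (u' - alt_sum alpha c k.+1 L)) ?normrN //.
by rewrite /u'; ring.
Qed.

(** Modulo 1 and up to the sign (-1)^m, the points n alpha are alternating sums starting at index m.
    [alt_sum_itv] confines them to the arc and [alt_sum_greedy] makes them dense in it; [cf_den_err]
    identifies the endpoints. *)
Lemma special_J_arc (R : realType) (alpha : R) (m : nat) :
  irrational alpha -> 0 < alpha < 1 -> (1 <= m)%N ->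
  exists lo hi : R, exists q q' : nat,
    [/\ lo < hi, hi <= lo + 1, cong1 lo (- (q%:R * alpha)),
        cong1 hi (- (q'%:R * alpha)) &
        forall g : R, special_J alpha m (\pi_(circle R) g) =
          [set \pi_(circle R) (g + t) | t in `[lo, hi]]].
Proof.
move=> ai a01 m1; have e0 j := cf_err_gt0 j ai.
pose s : R := (-1) ^+ m.
have sV : s = 1 \/ s = -1.
  by rewrite /s -signr_odd; case: odd; rewrite ?expr1 ?expr0; [right|left].
have [qc1 qc2] : cong1 (s * - cf_err alpha m.+1) (- ((cf_den alpha m)%:R * alpha)) /\
   cong1 (s * cf_err alpha m) (- ((cf_den alpha m.-1)%:R * alpha)).
  split; first by rewrite mulrN; apply/cong1N/cong1_sym/cf_den_err.
  have := cf_den_err m.-1 ai a01; rewrite prednK // => /cong1_sym /cong1N.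
  by rewrite -mulNr -[X in X * _]mulN1r -exprS prednK.
(* Indeed d_(m-1) + d_m <= a_m d_(m-1) + d_m = d_(m-2) <= 1. *)
have len : cf_err alpha m + cf_err alpha m.+1 <= 1.
  have := cf_errSS m.-1 ai; rewrite prednK //.
  have : cf_err alpha m <= (cf_digit alpha m)%:R * cf_err alpha m.
    apply: ler_peMl; first exact: ltW (e0 _).
    by rewrite ler1n -(prednK m1) cf_digit_gt0.
  have : cf_err alpha m.-1 <= 1.
    elim: m.-1 => [|j IH]; first by rewrite cf_err0.
    exact: le_trans (cf_err_dec j ai) IH.
  lra.
(* Both parities at once: [lo, hi] is s times [-d_m, d_(m-1)], so the ends swap roles when m is
   odd. *)
suff JE (lo hi : R) : lo < hi -> hi <= lo + 1 ->
    (forall u, (lo <= s * u <= hi) = (- cf_err alpha m.+1 <= u <= cf_err alpha m)) ->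
    forall g : R, special_J alpha m (\pi_(circle R) g) =
          [set \pi_(circle R) (g + t) | t in `[lo, hi]].
  have := e0 m; have := e0 m.+1; case: sV qc1 qc2 JE => ->.
    rewrite !mul1r => qc1 qc2 JE e1 em.
    exists (- cf_err alpha m.+1), (cf_err alpha m), (cf_den alpha m), (cf_den alpha m.-1).
    split=> //; [lra|lra|].
    by apply: JE; [lra|lra|move=> u; rewrite mul1r].
  rewrite !mulN1r opprK => qc1 qc2 JE e1 em.
  exists (- cf_err alpha m), (cf_err alpha m.+1), (cf_den alpha m.-1), (cf_den alpha m).
  split=> //; [lra|lra|].
  by apply: JE; [lra|lra|move=> u; rewrite mulN1r lerN2 lerNl andbC].
move=> lohi hilo lohiE g.
have sumE c N : cong1 ((\sum_(0 <= k < N) c k.+1 * cf_den alpha k)%:R * alpha)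
    (\sum_(0 <= k < N) (c k.+1)%:R * ((-1) ^+ k * cf_err alpha k.+1)).
  rewrite natr_sum mulr_suml; elim: N => [|N IH]; first by rewrite !big_nil; exact: cong1_refl.
  rewrite !big_nat_recr //=; apply: cong1D => //.
  by rewrite natrM -mulrA; apply/cong1Mn/cf_den_err.
suff closureE : closure [set \pi_(circle R) (n%:R * alpha) | n in ostrowski_from alpha m]
    = [set \pi_(circle R) t | t in `[lo, hi]].
  rewrite /special_J closureE; apply/seteqP; split=> x /=.
    by move=> [_ [t tI <-] <-]; exists t => //; rewrite pi_circleD.
  by move=> [t tI <-]; exists (\pi_(circle R) t); [exists t|rewrite pi_circleD].
apply/seteqP; split.
  (* The arc is closed, so it contains the closure once it contains the points. *)
  have cl : closed [set \pi_(circle R) t | t in `[lo, hi]].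
    by apply: closed_circle_arc => //; exact: ltW.
  rewrite [X in _ `<=` X](closure_id _).1 //; apply: closure_subset.
  move=> _ [n [c [c1 ca cM [N cN nE]] cm] <-].
  exists (s * alt_sum alpha c m N).
    by rewrite /= in_itv /= lohiE alt_sum_itv // => j mj; apply: ca; lia.
  apply/pi_circle_eq/cong1_sym; rewrite nE; apply: cong1_trans (sumE c N) _.
  rewrite -alt_sumE (_ : \sum_(_ <= _ < _) _ = \sum_(0 <= k < m + N)
     (c k.+1)%:R * ((-1) ^+ k * cf_err alpha k.+1)).
    rewrite (@big_cat_nat _ _ _ m 0 (m + N)) ?leq_addr //= big_nat big1.
      by rewrite add0r; exact: cong1_refl.
    by move=> j /andP[_ jm]; rewrite cm // mul0r.
  rewrite (@big_cat_nat _ _ _ N 0 (m + N)) ?leq_addl //= [X in _ + X]big_nat.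
  rewrite [X in _ + X]big1 ?addr0 // => j /andP[Nj _].
  by rewrite cN // mul0r.
move=> _ [t tI <-] B piB.
have : nbhs t ((fun t : R => \pi_(circle R) t) @^-1` B) by exact: (@pi_continuous _ _ t B piB).
move=> /nbhs_ballP[e /= e_gt0 eB].
have [K Ke] := cf_err_small ai e_gt0.
have ssE u : s * (s * u) = u by case: sV => ->; rewrite ?mul1r // !mulN1r opprK.
have normsE u : `|s * u| = `|u| by case: sV => ->; rewrite ?mul1r // mulN1r normrN.
have /andP[ul uu] : - cf_err alpha m.+1 <= s * t <= cf_err alpha m.
  by move: tI; rewrite /= in_itv /= -lohiE ssE.
(* No nonzero digit precedes index m, so the flag starts at [false]; K digits bring the error below
   the radius [e]. *)
have [|c [ca cM cz _ cu]] := @alt_sum_greedy R alpha K m false (s * t) ai ul.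
  by rewrite subr0.
exists (\pi_(circle R) ((\sum_(0 <= k < m + K) c k.+1 * cf_den alpha k)%N%:R * alpha)).
split.
  exists (\sum_(0 <= k < m + K) c k.+1 * cf_den alpha k)%N => //.
  exists c; last by move=> k km; apply: cz; rewrite km.
  split.
  - by rewrite cz ?m1 // cf_digit_gt0.
  - by move=> [|k] // _; apply: ca.
  - by move=> k k1 ck; apply: cM.
  - by exists (m + K)%N => // k mKk; apply: cz; rewrite mKk orbT.
have -> : \pi_(circle R) ((\sum_(0 <= k < m + K) c k.+1 * cf_den alpha k)%N%:R * alpha) =
    \pi_(circle R) (s * alt_sum alpha c m K).
  apply/pi_circle_eq/(cong1_trans (sumE c _)); rewrite -alt_sumE.
  rewrite (@big_cat_nat _ _ _ m 0 (m + K)) ?leq_addr //= big_nat big1.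
    by rewrite add0r; exact: cong1_refl.
  by move=> j /andP[_ jm]; rewrite cz ?jm // mul0r.
apply: eB; rewrite /ball /= -normsE mulrBr ssE.
by apply: le_lt_trans cu _; apply: Ke; rewrite leq_addl.
Qed.

(** * Bounded remainder sets of integers *)

(** [G] is a two-sided counting function: for M <= N, G N - G M counts the elements of [T] in [M,
    N[. The explicit [C] allows bounds uniform over families of sets. *)
Definition bounded_remainder (R : realType) (T : set int) (lam C : R) :=
  exists2 G : int -> int,
    forall N, G (N + 1) = G N + (`[<T N>] : nat)%:Z &
    forall N, `|(G N)%:~R - lam * N%:~R| <= C.

Lemma bounded_remainder_bigcup (R : realType) (N : nat) (T : 'I_N -> set int)
    (lam C : 'I_N -> R) :
  trivIset setT T ->
  (forall i, bounded_remainder (T i) (lam i) (C i)) ->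
  bounded_remainder (\bigcup_i T i) (\sum_i lam i) (\sum_i C i).
Proof.
move=> Td brT.
have /choice[G GP] : forall i, exists G : int -> int,
    (forall N, G (N + 1) = G N + (`[<T i N>] : nat)%:Z) /\
    (forall N, `|(G N)%:~R - lam i * N%:~R| <= C i).
  by move=> i; have [G] := brT i; exists G.
exists (fun n => \sum_i G i n) => n; last first.
  rewrite rmorph_sum /= mulr_suml -sumrB.
  apply: le_trans (ler_norm_sum _ _ _) _.
  by apply: ler_sum => i _; apply: (GP i).2.
rewrite (eq_bigr _ (fun i _ => (GP i).1 n)) big_split /=; congr (_ + _).
case: asboolP => [[i _ Tin]|nT].
  rewrite (bigD1 i) //= big1 ?addr0 => [|j ji]; first by rewrite asboolT.
  rewrite asboolF // => Tjn; move/eqP: ji; apply.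
  by apply: Td => //; exists n.
by rewrite big1 // => i _; rewrite asboolF // => Tin; apply: nT; exists i.
Qed.

Lemma bounded_remainderU (R : realType) (T T' : set int) (lam lam' C C' : R) :
  (forall n, T n -> T' n -> False) ->
  bounded_remainder T lam C -> bounded_remainder T' lam' C' ->
  bounded_remainder (T `|` T') (lam + lam') (C + C').
Proof.
move=> TT' [G GS GC] [G' GS' GC']; exists (fun n => G n + G' n) => n.
  rewrite GS GS' addrACA; congr (_ + _).
  case: (asboolP (T n)) (asboolP (T' n)) => [Tn|nTn] [T'n|nT'n].
  - by have := TT' _ Tn T'n.
  - by rewrite asboolT //; left.
  - by rewrite asboolT //; right.
  - by rewrite asboolF // => -[].
rewrite intrD mulrDl opprD addrACA.
exact: le_trans (ler_normD _ _) (lerD (GC n) (GC' n)).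
Qed.

(** The counting function is at most a unit step. This absorbs the right endpoint of a closed
    arc. *)
Lemma bounded_remainder_subsingleton (R : realType) (T : set int) :
  (forall m n, T m -> T n -> m = n) -> bounded_remainder T (0 : R) 1.
Proof.
move=> T1; have [[n0 Tn0]|nT] := pselect (exists n, T n); last first.
  exists (fun=> 0) => n; last by rewrite mul0r subrr normr0.
  by rewrite asboolF // => Tn; apply: nT; exists n.
exists (fun n => ((n0 < n)%R : nat)%:Z) => n; last first.
  by rewrite mul0r subr0; case: ltP => _; rewrite ?normr0 ?normr1.
have [->|nn0] := eqVneq n n0; first by rewrite asboolT // ltxx; lia.
by rewrite asboolF; [lia|move=> /T1 /(_ Tn0) /eqP; rewrite (negbTE nn0)].
Qed.

(** The difference of the floors counts the integers z with y - hi < z <= y - lo, and there is at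
    most one since hi - lo <= 1. *)
Lemma floor_arc (R : realType) (lo hi y : R) : lo <= hi -> hi <= lo + 1 ->
  Num.floor (y - lo) = Num.floor (y - hi) +
    (`[< exists z : int, lo + z%:~R <= y < hi + z%:~R >] : nat)%:Z.
Proof.
move=> lohi hilo.
have /andP[al au] := floor_itv (y - lo).
have /andP[bl bu] := floor_itv (y - hi).
move: (Num.floor (y - lo)) (Num.floor (y - hi)) al au bl bu => a b.
rewrite !intrD => al au bl bu.
have ba : b < a + 1 by rewrite -(ltr_int R) intrD; lra.
have ab : a < b + 2 by rewrite -(ltr_int R) intrD; lra.
case: asboolP => [[z /andP[zl zu]]|nz].
  have za : z < a + 1 by rewrite -(ltr_int R) intrD; lra.
  have bz : b < z by rewrite -(ltr_int R); lra.
  lia.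
have [//|ba1] : a = b \/ a = b + 1 by lia.
  by lia.
case: nz; exists a; rewrite ba1 intrD in al *; lra.
Qed.

Lemma floorD_norm (R : realType) (x y : R) :
  `|(Num.floor (x + y) - Num.floor x)%:~R - y| <= 1.
Proof.
have /andP[] := floor_itv (x + y); have /andP[] := floor_itv x.
by rewrite !intrD rmorphN /= ler_norml; lra.
Qed.

(* The indicator of an arc with endpoints in [Z alpha + Z] is a difference of
   floors whose Birkhoff sums telescope, with a bound independent of [c]. *)
Lemma bounded_remainder_half_open (R : realType) (alpha lo hi : R) (q q' : nat) 
    (c : R) :
  lo <= hi -> hi <= lo + 1 ->
  cong1 lo (- (q%:R * alpha)) -> cong1 hi (- (q'%:R * alpha)) ->
  bounded_remainder
    [set n : int | exists z : int, lo + z%:~R <= n%:~R * alpha + c < hi + z%:~R]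
    (hi - lo) (q + q')%:R.
Proof.
move=> lohi hilo /intrP[P PE] /intrP[P' PE'].
pose g (n : int) : int := Num.floor (n%:~R * alpha + c).
(* Each of the r summands is within 1 of N alpha whatever [c] is, by [floorD_norm]; the increment in
   N telescopes. *)
pose F (r : nat) (N : int) : int := \sum_(0 <= j < r) (g (N + j%:Z) - g j%:Z).
have FS r N : F r (N + 1) = F r N + (g (N + r%:Z) - g N).
  have := telescope_sumr (fun j : nat => g (N + j%:Z)) (leq0n r).
  rewrite addr0 => <-; rewrite -big_split /=; apply: eq_bigr => j _.
  by rewrite -addrA -[1 + _]/(Posz j.+1); ring.
have FC r N : `|(F r N)%:~R - r%:R * alpha * N%:~R| <= r%:R.
  rewrite (_ : _ - _ = \sum_(0 <= j < r) ((g (N + j%:Z) - g j%:Z)%:~R - N%:~R * alpha)).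
    apply: le_trans (ler_norm_sum _ _ _) _.
    apply: le_trans (ler_sum _ (_ : forall j, true -> _ <= 1)) _ => [j _|].
      rewrite /g [_ * alpha + c](_ : _ = (j%:~R * alpha + c) + N%:~R * alpha).
        exact: floorD_norm.
      by rewrite intrD; ring.
    by rewrite sumr_const_nat subn0.
  rewrite sumrB sumr_const_nat subn0 -mulr_natr rmorph_sum /=; congr (_ - _); ring.
(* The linear term supplies the integer part of hi - lo = (q - q') alpha + (P' - P). *)
exists (fun N => F q N - F q' N + (P' - P) * N) => N; last first.
  have := FC q N; have := FC q' N.
  rewrite natrD !ler_norml !intrD !rmorphN intrM intrD rmorphN /=.
  rewrite -PE -PE'; lra.
(* Subtracting an endpoint amounts to advancing the orbit by r steps, up to an integer. *)
have floorE r x (Q : int) : x - - (r%:R * alpha) = Q%:~R ->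
    Num.floor (N%:~R * alpha + c - x) = g (N + r%:Z) - Q.
  move=> xE; apply/floor_def; have := floor_itv ((N + r%:Z)%:~R * alpha + c).
  rewrite -/(g (N + r%:Z)) !intrD rmorphN /= -xE -pmulrn.
  lra.
rewrite !FS; have := floor_arc (N%:~R * alpha + c) lohi hilo.
rewrite (floorE _ _ _ PE) (floorE _ _ _ PE') => h.
rewrite [RHS](_ : _ = F q N - F q' N + (P' - P) * N +
    (g (N + q%:Z) - P - (g (N + q'%:Z) - P'))).
  by ring.
by rewrite h; congr (_ + _); rewrite [RHS]addrC addKr.
Qed.

(** The right endpoint adds at most one integer: two visits to it would make [alpha] rational. Hence
    the extra 1 in the bound. *)
Lemma bounded_remainder_arc (R : realType) (alpha lo hi : R) (q q' : nat) (c : R) :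
  irrational alpha -> lo <= hi -> hi <= lo + 1 ->
  cong1 lo (- (q%:R * alpha)) -> cong1 hi (- (q'%:R * alpha)) ->
  bounded_remainder
    [set n : int | exists z : int, lo + z%:~R <= n%:~R * alpha + c <= hi + z%:~R]
    (hi - lo) (q + q').+1%:R.
Proof.
move=> ai lohi hilo loq hiq.
have br0 := bounded_remainder_half_open c lohi hilo loq hiq.
set T0 := [set _ | _] in br0; set T := [set _ | _].
have br1 : bounded_remainder (T `\` T0) (0 : R) 1.
  have endpt n : (T `\` T0) n -> exists z : int, n%:~R * alpha + c = hi + z%:~R.
    move=> [[z /andP[zl zh]] nT0]; exists z; apply/eqP; rewrite eq_le zh leNgt.
    by apply/negP => zn; apply: nT0; exists z; rewrite zl zn.
  apply: bounded_remainder_subsingleton => m n /endpt[z zE] /endpt[w wE].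
  apply/eqP; rewrite -subr_eq0; apply/negPn/negP => mn0; apply: ai.
  exists ((z - w)%:~R / (m - n)%:~R) => //.
  rewrite fmorph_div /= !ratr_int; apply: (canLR (mulfK _)).
    by rewrite intr_eq0.
  rewrite !intrD !rmorphN /=; lra.
have := bounded_remainderU _ br0 br1.
rewrite addr0 natr1 (_ : T0 `|` _ = T); first by apply=> n T0n [].
rewrite setDUK // => n [z /andP[zl zh]]; exists z.
by rewrite zl ltW.
Qed.

(* The counting function itself enumerates [T] monotonically. *)
Lemma bounded_remainder_bij (R : realType) (T : set int) (lam C : R) :
  0 < lam -> bounded_remainder T lam C ->
  exists2 G : int -> int, set_bij T setT G &
    forall n, `|(G n)%:~R - lam * n%:~R| <= C.
Proof.
move=> lam0 [G GS GC]; exists G => //.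
have Gmono m n : m <= n -> G m <= G n.
  move=> mn; rewrite -(subrK m n) addrC -(gez0_abs (_ : 0 <= n - m)) ?subr_ge0 //.
  elim: `|n - m|%N => [|k IH]; first by rewrite addr0.
  by rewrite -addn1 PoszD addrA GS (le_trans IH) // lerDl.
have Glt m n : T m -> m < n -> G m < G n.
  move=> Tm mn; apply: (@lt_le_trans _ _ (G (m + 1))).
    by rewrite GS asboolT // ltrDl.
  by apply: Gmono; lia.
split=> // [m n /set_mem Tm /set_mem Tn Gmn|z _].
  by case: (ltgtP m n) => // /Glt; rewrite Gmn ltxx; [move/(_ Tm)|move/(_ Tn)].
(* Chosen so that lam n0 + C <= z < lam n1 - C, which brackets z between values of [G]. *)
pose n0 := Num.floor ((z%:~R - C) / lam).
pose n1 := Num.floor ((z%:~R + C) / lam) + 1.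
have Gn0 : G n0 <= z.
  have /andP[+ _] := floor_itv ((z%:~R - C) / lam).
  rewrite -/n0 ler_pdivlMr // mulrC => h.
  by rewrite -(ler_int R); have := GC n0; rewrite ler_norml; lra.
have Gn1 : z < G n1.
  have /andP[_] := floor_itv ((z%:~R + C) / lam).
  rewrite -/n1 ltr_pdivrMr // mulrC => h.
  by rewrite -(ltr_int R); have := GC n1; rewrite ler_norml; lra.
(* At the least such k, [G] has just jumped past z, so the preceding integer lies in [T] and has
   value z. *)
have exk : exists k : nat, z < G (n0 + k%:Z).
  exists `|n1 - n0|%N; apply: (lt_le_trans Gn1); apply: Gmono.
  by rewrite -lerBlDl abszE ler_norm.
case: (ex_minnP exk) => -[|k]; first by rewrite addr0 ltNge Gn0.
move=> zk kmin; have Gk : G (n0 + k%:Z) <= z.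
  by rewrite leNgt; apply/negP => /kmin; rewrite ltnn.
move: zk; rewrite -addn1 PoszD addrA GS; case: asboolP => [Tk|_] zk.
  by exists (n0 + k%:Z) => //; apply/le_anti; rewrite Gk -ltzD1.
by move: zk; rewrite addr0 ltNge Gk.
Qed.

(** The translation by [gamma] goes into the phase [c], and the integer part of [a] vanishes modulo
    1. As [lam] and [C] precede [c], one bound serves all rows. *)
Lemma special_interval_bounded_remainder (R : realType) (a : R) (J : set (circle R)) :
  irrational a -> special_interval (fractional_part a) J ->
  exists lam C : R, 0 < lam /\ forall c,
    bounded_remainder [set n : int | J (\pi_(circle R) (n%:~R * a + c))] lam C.
Proof.
move=> ai [m m1 [gamma ->]].
have fi := irrational_fractional_part ai.
have f01 : 0 < fractional_part a < 1.
  have /andP[f0 ->] := fractional_part_itv a.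
  by rewrite lt0r f0 irrational_neq0.
have [lo [hi [q [q' [lohi hilo loq hiq JE]]]]] := special_J_arc fi f01 m1.
have [g ->] := pi_circle_surj gamma; rewrite JE.
exists (hi - lo), (q + q').+1%:R; split=> [|c]; first by rewrite subr_gt0.
have := bounded_remainder_arc (c - g) fi (ltW lohi) hilo loq hiq.
congr bounded_remainder; apply/seteqP; split=> k /=.
  move=> [z /andP[zl zh]]; exists (k%:~R * fractional_part a + (c - g) - z%:~R).
    by rewrite /= in_itv /=; lra.
  apply/pi_circle_eq/intrP; exists (- k * Num.floor a - z).
  rewrite intrD intrM !rmorphN /= /fractional_part; ring.
move=> [t]; rewrite /= in_itv /= => /andP[tl th] /pi_circle_eq /intrP[z zE].
exists (- z - k * Num.floor a).
have tE : t = k%:~R * a + c + z%:~R - g by rewrite -zE; ring.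
rewrite tE in tl th; rewrite intrD mulrC -mulNr intrM !rmorphN /= /fractional_part; lra.
Qed.

(** Densities and bounds add over the disjoint pieces; nonemptiness provides a piece, hence a
    positive total density. *)
Lemma special_union_bounded_remainder (R : realType) (a : R) (I : set (circle R)) :
  irrational a -> special_union (fractional_part a) I -> I !=set0 ->
  exists lam C : R, 0 < lam /\ forall c,
    bounded_remainder [set n : int | I (\pi_(circle R) (n%:~R * a + c))] lam C.
Proof.
move=> ai [N [J [Jsp Jd ->]]] [_ [i0 _ _]].
have /choice[lam /choice[C lamC]] : forall i, exists lam, exists C : R, 0 < lam /\ forall c,
    bounded_remainder [set n : int | J i (\pi_(circle R) (n%:~R * a + c))] lam C.
  by move=> i; apply: special_interval_bounded_remainder.
exists (\sum_i lam i), (\sum_i C i); split=> [|c].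
  rewrite (bigD1 i0) //= ltr_pwDl ?(lamC i0).1 // sumr_ge0 // => i _.
  exact: ltW (lamC i).1.
rewrite [X in bounded_remainder X](_ : _ =
    \bigcup_i [set n : int | J i (\pi_(circle R) (n%:~R * a + c))]); last first.
  by apply/seteqP; split=> n [i _ Jin]; exists i.
apply: bounded_remainder_bigcup => [i j _ _ [n [Jin Jjn]]|i]; last exact: (lamC i).2.
by apply: Jd => //; exists (\pi_(circle R) (n%:~R * a + c)).
Qed.

(** * Hyperplanes as graphs *)

Lemma rV_norm_le (R : realType) (k : nat) (v : 'rV[R]_k) (C : R) :
  0 <= C -> (forall j, `|v 0 j| <= C) -> `|v| <= C.
Proof.
move=> C0 vC; rewrite /Num.norm /= mx_normrE; apply: bigmax_le => // -[i j] _.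
by rewrite (ord1 i).
Qed.

Lemma ler_rV_norm (R : realType) (k : nat) (v : 'rV[R]_k) j : `|v 0 j| <= `|v|.
Proof.
rewrite [leRHS]/Num.norm /= mx_normrE.
exact: (le_bigmax _ (fun ij : 'I_1 * 'I_k => `|v ij.1 ij.2|) (0, j)).
Qed.

Lemma pi_torus_eq (R : realType) (k : nat) (u v : 'rV[R]_k) :
  \pi_(torus R k) u = \pi_(torus R k) v <-> forall j, cong1 (u 0 j) (v 0 j).
Proof.
have -> : \pi_(torus R k) u = \pi_(torus R k) v <-> u - v \is a mxOver Num.int.
  have := Quotient.idealrBE (GRing.ZmodClosed.clone 'rV[R]_k (@Zkpred R k) _) u v.
  by rewrite unfold_in /Zkpred => ->; split=> [->|/eqP].
split=> [/mxOverP uvZ j|uvZ]; first by have := uvZ 0 j; rewrite !mxE.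
by apply/mxOverP => i j; rewrite !mxE (ord1 i); exact: uvZ.
Qed.

Definition slope_graph (R : realType) (n : nat) (alpha y : 'rV[R]_n) : 'rV[R]_n.+1 :=
  \row_j (if unlift ord_max j is Some i then y 0 i
          else \sum_(i < n) y 0 i * alpha 0 i).

Section slope_graph.
Context (R : realType) (n : nat) (alpha : 'rV[R]_n).
Implicit Types (y : 'rV[R]_n) (v : 'rV[R]_n.+1).
Local Notation phi := (slope_graph alpha).

Definition slope_proj v : 'rV[R]_n := \row_i v 0 (lift ord_max i).
Local Notation proj := slope_proj.

Lemma slope_graph_lift y i : phi y 0 (lift ord_max i) = y 0 i.
Proof. by rewrite mxE liftK. Qed.

Lemma slope_graph_max y : phi y 0 ord_max = \sum_(i < n) y 0 i * alpha 0 i.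
Proof. by rewrite mxE unlift_none. Qed.

Lemma slope_graphK : cancel phi proj.
Proof. by move=> y; apply/rowP => i; rewrite mxE slope_graph_lift. Qed.

Lemma slope_graph_is_linear : linear phi.
Proof.
move=> a u v; apply/rowP => j; rewrite !mxE; case: unliftP => [i _|_].
  by rewrite !mxE.
rewrite mulr_sumr -big_split /=; apply: eq_bigr => i _.
by rewrite !mxE mulrDl mulrA.
Qed.

HB.instance Definition _ :=
  GRing.isLinear.Build R 'rV[R]_n 'rV[R]_n.+1 _ phi slope_graph_is_linear.

Lemma mem_slopes (V : {vspace 'rV[R]_n.+1}) v :
  slopes V alpha -> (v \in V <-> phi (proj v) = v).
Proof.
move=> sV; split=> [/sV vV|<-].
  apply/rowP => j; rewrite mxE; case: unliftP => [i ->|->]; first by rewrite mxE.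
  by rewrite vV; apply: eq_bigr => i _; rewrite mxE.
apply/sV; rewrite slope_graph_max; apply: eq_bigr => i _.
by rewrite slope_graph_lift.
Qed.

(** With [slope_graph_norm_ge], this lets distances in V be estimated on the first n coordinates. *)
Lemma slope_graph_norm y (C : R) : 0 <= C -> (forall i, `|y 0 i| <= C) ->
  `|phi y| <= (1 + \sum_i `|alpha 0 i|) * C.
Proof.
move=> C0 yC; have a0 : 0 <= \sum_i `|alpha 0 i| by apply: sumr_ge0.
apply: rV_norm_le => [|j]; first by rewrite mulr_ge0 // addr_ge0.
rewrite mxE; case: unliftP => [i _|_].
  by apply: le_trans (yC i) _; rewrite ler_peMl // lerDl.
apply: le_trans (ler_norm_sum _ _ _) _.
rewrite mulrDl mul1r mulr_suml; apply: le_trans (_ : _ <= \sum_i `|alpha 0 i| * C) _.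
  by apply: ler_sum => i _; rewrite normrM mulrC ler_wpM2l.
by rewrite lerDr.
Qed.

Lemma slope_graph_norm_ge y i : `|y 0 i| <= `|phi y|.
Proof. by rewrite -slope_graph_lift ler_rV_norm. Qed.

End slope_graph.

(** The window lies in the image of the line of [e_last], where all coordinates but the last vanish
    modulo 1. *)
Lemma cut_and_project_slopes (R : realType) (n : nat) (V : {vspace 'rV[R]_n.+1})
    (alpha : 'rV[R]_n) (I : set (circle R)) (x v : 'rV[R]_n.+1) :
  slopes V alpha ->
  cut_and_project V (window I) x v <->
  [/\ v \in V, forall i, v 0 (lift ord_max i) + x 0 (lift ord_max i) \is a Num.int &
      I (\pi_(circle R) (v 0 ord_max + x 0 ord_max))].
Proof.
move=> sV; split=> [[vV [t /= It /pi_torus_eq tE]]|[vV vZ Iv]].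
  split=> // [i|].
    have := tE (lift ord_max i); rewrite /cong1 !mxE eqxx /=.
    by rewrite eq_sym (negbTE (neq_lift _ _)) mulr0 sub0r rpredN.
  have := tE ord_max; rewrite !mxE !eqxx mulr1 => /pi_circle_eq <- //.
split=> //; exists (v 0 ord_max + x 0 ord_max) => //.
apply/pi_torus_eq => j; rewrite !mxE eqxx /=.
case: (unliftP ord_max j) => [i|] ->; last by rewrite eqxx mulr1; exact: cong1_refl.
by rewrite eq_sym (negbTE (neq_lift _ _)) mulr0 /cong1 sub0r rpredN.
Qed.

Definition slope_lattice (R : realType) (n : nat) (alpha : 'rV[R]_n) (s : 'I_n -> R) :=
  [set slope_graph alpha (\row_i (s i * (w i)%:~R)) | w in [set: 'I_n -> int]].

Lemma slope_lattice_lattice_in (R : realType) (n : nat) (V : {vspace 'rV[R]_n.+1})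
    (alpha : 'rV[R]_n) (s : 'I_n -> R) :
  slopes V alpha -> \dim V = n -> (forall i, s i != 0) ->
  lattice_in V (slope_lattice alpha s).
Proof.
move=> sV V_dim s0.
pose B i := slope_graph alpha (s i *: delta_mx 0 i).
pose b := [tuple B (cast_ord V_dim i) | i < \dim V].
have castK : {on predT, bijective (cast_ord V_dim)}.
  exists (cast_ord (esym V_dim)) => i _; [exact: cast_ordK|exact: cast_ordKV].
have phiE c : slope_graph alpha (\row_i (s i * c i)) = \sum_i c i *: B i.
  rewrite [X in slope_graph _ X]row_sum_delta linear_sum; apply: eq_bigr => i _.
  by rewrite mxE mulrC -scalerA linearZ.
exists b.
  (* Spanning suffices, since the number of vectors is the dimension. *)
  rewrite basisEdim size_tuple leqnn andbT; apply/subvP => v /(mem_slopes _ sV) <-.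
  rewrite (_ : slope_proj v = \row_i (s i * (v 0 (lift ord_max i) / s i))); last first.
    by apply/rowP => i; rewrite !mxE mulrC divfK.
  rewrite phiE; apply: memv_suml => i _; apply/memvZ/memv_span.
  by rewrite -(cast_ordKV V_dim i) -(tnth_mktuple (fun j => B (cast_ord V_dim j))) mem_tnth.
have bE (i : 'I_(\dim V)) : b`_i = B (cast_ord V_dim i) by rewrite -tnth_nth tnth_mktuple.
apply/seteqP; split=> [_ [w _ <-]|_ [z _ <-]].
  exists (w \o cast_ord V_dim) => //; rewrite phiE (reindex (cast_ord V_dim)) //=.
  by apply: eq_bigr => i _; rewrite bE scaler_int.
exists (z \o cast_ord (esym V_dim)) => //; rewrite phiE (reindex (cast_ord V_dim)) //=.
by apply: eq_bigr => i _; rewrite bE cast_ordK scaler_int.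
Qed.

Lemma slope_lattice_separated (R : realType) (n : nat) (V : {vspace 'rV[R]_n.+1})
    (alpha : 'rV[R]_n) (s : 'I_n -> R) (r C : R) :
  slopes V alpha -> 0 < r -> (forall i, r <= s i <= C) ->
  separated_net V (slope_lattice alpha s).
Proof.
move=> sV r0 sC; split.
- by move=> _ [w _ <-]; apply/(mem_slopes _ sV); rewrite slope_graphK.
- exists r => // _ _ [w _ <-] [w' _ <-] ww'.
  have [i wi] : exists i, w i != w' i.
    apply/existsP; apply: contraNT ww'; rewrite negb_exists => /forallP we.
    apply/eqP; congr slope_graph; apply/rowP => i; rewrite !mxE.
    by move/negPn/eqP: (we i) => ->.
  rewrite -linearB; apply: le_trans (slope_graph_norm_ge alpha _ i).
  rewrite !mxE -mulrBr -intrB normrM.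
  have /andP[ri _] := sC i; apply: (le_trans ri).
  rewrite ger0_norm; last exact: le_trans (ltW r0) ri.
  rewrite ler_peMr ?(le_trans (ltW r0)) // -intr_norm ler1z -gtz0_ge1 normr_gt0 subr_eq0 //.
(* For n = 0 the hypothesis on [s] does not force [C] to be nonnegative. *)
pose C' := Num.max C 0.
exists ((1 + \sum_i `|alpha 0 i|) * C') => v /(mem_slopes _ sV) vE.
exists (slope_graph alpha (\row_i (s i * (Num.floor (v 0 (lift ord_max i) / s i))%:~R))).
  by exists (fun i => Num.floor (v 0 (lift ord_max i) / s i)).
rewrite -{1}vE -linearB; apply: slope_graph_norm => [|i]; first by rewrite le_max lexx orbT.
have /andP[ri iC] := sC i; have s0 := lt_le_trans r0 ri.
pose t := v 0 (lift ord_max i) / s i; have vt : v 0 (lift ord_max i) = s i * t.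
  by rewrite mulrC divfK ?lt0r_neq0.
rewrite !mxE -/t vt -mulrBr normrM gtr0_norm // le_max; apply/orP; left.
apply: le_trans iC; rewrite ler_piMr ?(ltW s0) // ger0_norm.
  by have /andP[_ /ltW] := fractional_part_itv t.
by have /andP[] := fractional_part_itv t.
Qed.

(** * The bijection with a lattice *)

Lemma cut_and_project_uniformly_discrete (R : realType) (n : nat)
    (V : {vspace 'rV[R]_n.+1}) (alpha : 'rV[R]_n) (I : set (circle R))
    (x : 'rV[R]_n.+1) :
  slopes V alpha -> uniformly_discrete (cut_and_project V (window I) x).
Proof.
move=> sV; exists 1 => // v v' /(cut_and_project_slopes _ _ _ sV)[vV vZ _].
move=> /(cut_and_project_slopes _ _ _ sV)[v'V v'Z _] vv'.
have [i vi] : exists i, v 0 (lift ord_max i) != v' 0 (lift ord_max i).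
  apply/existsP; apply: contraNT vv'; rewrite negb_exists => /forallP ve.
  have /(mem_slopes _ sV) <- := vV; have /(mem_slopes _ sV) <- := v'V.
  apply/eqP; congr slope_graph; apply/rowP => i; rewrite !mxE.
  by move/negPn/eqP: (ve i).
apply: le_trans (ler_rV_norm _ (lift ord_max i)).
have /intrP[z zE] := vZ i; have /intrP[z' zE'] := v'Z i.
have dE : v 0 (lift ord_max i) - v' 0 (lift ord_max i) = (z - z')%:~R.
  by rewrite intrB -zE -zE'; ring.
rewrite !mxE dE -intr_norm ler1z -gtz0_ge1 normr_gt0.
by rewrite -(intr_eq0 R) -dE subr_eq0.
Qed.

(** A bounded displacement enlarges the covering radius by at most its bound, so density of the net
    follows from that of the lattice. *)
Lemma relatively_dense_bij (R : realType) (k : nat) (V : {vspace 'rV[R]_k})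
    (Y L : set 'rV[R]_k) (f : 'rV[R]_k -> 'rV[R]_k) :
  set_bij Y L f -> has_ubound [set `|f y - y| | y in Y] ->
  relatively_dense V L -> relatively_dense V Y.
Proof.
move=> [_ _ fsurj] [B BP] [r rP]; exists (r + B) => v /rP[l Ll vl].
have [y Yy fy] := fsurj _ Ll; exists y => //.
rewrite -(subrK l v) -addrA; apply: le_trans (ler_normD _ _) (lerD vl _).
by rewrite -fy; apply: BP; exists y.
Qed.

Section row_bijection.
Context (R : realType) (n : nat) (V : {vspace 'rV[R]_n.+2}) (alpha : 'rV[R]_n.+1).
Context (x : 'rV[R]_n.+2) (I : set (circle R)) (lam C : R) (G : R -> int -> int).
Hypothesis sV : slopes V alpha.
Hypothesis lam0 : 0 < lam.
Let T c := [set m : int | I (\pi_(circle R) (m%:~R * alpha 0 0 + c))]%qT.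
Hypothesis Gbij : forall c, set_bij (T c) setT (G c).
Hypothesis Gdist : forall c m, `|(G c m)%:~R - lam * m%:~R| <= C.

Let y (v : 'rV[R]_n.+2) (i : 'I_n.+1) : R := v 0 (lift ord_max i).
(** On the cut-and-project set the argument is already an integer, so the floor loses nothing. *)
Let z (v : 'rV[R]_n.+2) (i : 'I_n.+1) : int := Num.floor (y v i + y x i).
(** The phase of a row: what remains of the last coordinate of v + x after removing z_0 alpha_1. It
    ignores [w 0], so it is constant along the row. *)
Let shift (w : 'I_n.+1 -> R) : R :=
  \sum_(i < n.+1 | i != 0) (w i - y x i) * alpha 0 i + x 0 ord_max - y x 0 * alpha 0 0.
Let w (v : 'rV[R]_n.+2) (i : 'I_n.+1) : int :=
  if i == 0 then G (shift (fun i => (z v i)%:~R)) (z v 0) else z v i.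
Let s (i : 'I_n.+1) : R := if i == 0 then lam^-1 else 1.

Definition row_map (v : 'rV[R]_n.+2) : 'rV[R]_n.+2 :=
  slope_graph alpha (\row_i (s i * (w v i)%:~R)).

Lemma cut_and_project_rows v :
  cut_and_project V (window I) x v <->
  [/\ v \in V, forall i, y v i = (z v i)%:~R - y x i &
      T (shift (fun i => (z v i)%:~R)) (z v 0)].
Proof.
have vmax : v \in V -> (forall i, y v i = (z v i)%:~R - y x i) ->
    v 0 ord_max + x 0 ord_max =
    (z v 0)%:~R * alpha 0 0 + shift (fun i => (z v i)%:~R).
  move=> /sV -> yE; rewrite (bigD1 0) //= -/(y v 0) {1}yE /shift.
  rewrite (eq_bigr (fun i => ((z v i)%:~R - y x i) * alpha 0 i)); last first.
    by move=> i _; rewrite -yE.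
  ring.
split=> [/(cut_and_project_slopes _ _ _ sV)[vV vZ Iv]|[vV yE Tz]].
  have yE i : y v i = (z v i)%:~R - y x i.
    by have := vZ i; rewrite intrEfloor => /eqP h; rewrite /z h addrK.
  by split=> //; rewrite /T /= -vmax.
apply/(cut_and_project_slopes _ _ _ sV); split=> // [i|]; last by rewrite vmax.
by rewrite -/(y v i) yE subrK intr_int.
Qed.

(** The labels with i != 0 are kept, so rows go to rows, and on the row of phase c the map is the
    bijection [G c]. *)
Lemma row_map_bij :
  set_bij (cut_and_project V (window I) x) (slope_lattice alpha s) row_map.
Proof.
have s0 i : s i != 0 by rewrite /s; case: ifP => _; rewrite ?oner_eq0 // invr_eq0 gt_eqF.
split; [by move=> v _; exists (w v)| |move=> _ [w' _ <-]].
  move=> v v' /set_mem /cut_and_project_rows[vV yE Tz].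
  move=> /set_mem /cut_and_project_rows[v'V yE' Tz'] fvv'.
  have ww i : w v i = w v' i.
    have := congr1 (fun u => slope_proj u 0 i) fvv'.
    rewrite !slope_graphK !mxE => /(mulfI (s0 i)) /eqP.
    by rewrite eqr_int => /eqP.
  have zz i : i != 0 -> z v i = z v' i.
    by move=> /negbTE i0; have := ww i; rewrite /w i0.
  (* Both points lie in the same row, so injectivity of a single [G c] applies. *)
  have cc : shift (fun i => (z v i)%:~R) = shift (fun i => (z v' i)%:~R).
    rewrite /shift; congr (_ + _ - _); apply: eq_bigr => i i0.
    by rewrite zz.
  have z0 : z v 0 = z v' 0.
    have [_ Ginj _] := Gbij (shift (fun i => (z v i)%:~R)).
    apply: Ginj; rewrite ?inE //; first by rewrite cc.
    by have := ww 0; rewrite /w eqxx cc.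
  have /(mem_slopes _ sV) <- := vV; have /(mem_slopes _ sV) <- := v'V.
  congr slope_graph; apply/rowP => i; rewrite !mxE -!/(y _ i) yE yE'.
  by have [->|/zz ->] := eqVneq i 0; rewrite ?z0.
have [_ _ Gsurj] := Gbij (shift (fun i => (w' i)%:~R)).
have [m Tm Gm] := Gsurj (w' 0) Logic.I.
pose u i := if i == 0 then m else w' i.
pose v := slope_graph alpha (\row_i ((u i)%:~R - y x i)).
have yv i : y v i = (u i)%:~R - y x i by rewrite /y /v slope_graph_lift mxE.
have zv i : z v i = u i by rewrite /z yv subrK intrKfloor.
have cE : shift (fun i => (z v i)%:~R) = shift (fun i => (w' i)%:~R).
  rewrite /shift; congr (_ + _ - _); apply: eq_bigr => i /negbTE i0.
  by rewrite zv /u i0.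
exists v.
  apply/cut_and_project_rows; split=> [|i|]; last by rewrite cE zv /u eqxx.
    by apply/(mem_slopes _ sV); rewrite slope_graphK.
  by rewrite yv zv.
congr slope_graph; apply/rowP => i; rewrite !mxE; congr (_ * _%:~R).
rewrite /w; case: eqP => [->|/eqP/negbTE i0]; last by rewrite zv /u i0.
by rewrite cE zv /u eqxx.
Qed.

(** Coordinates with i != 0 move only by the offset of [x]; the first moves by at most C / lam more,
    from dividing [Gdist] by [lam]. *)
Lemma row_map_bounded :
  has_ubound [set `|row_map v - v| | v in cut_and_project V (window I) x].
Proof.
exists ((1 + \sum_i `|alpha 0 i|) * (C / lam + `|x|)).
move=> _ [v /cut_and_project_rows[vV yE Tz] <-].
have C0 : 0 <= C by apply: le_trans (Gdist 0 0).
have /(mem_slopes _ sV) {2}<- := vV.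
rewrite -linearB; apply: slope_graph_norm => [|i].
  by rewrite addr_ge0 // divr_ge0 // ltW.
rewrite !mxE -/(y v i) yE opprB addrCA addrC.
apply: le_trans (ler_normD _ _) (lerD _ (ler_rV_norm _ _)).
rewrite /s /w; case: eqP => [->|_]; last first.
  by rewrite mul1r subrr normr0 divr_ge0 // ltW.
rewrite -[X in _ - X](mulKf (lt0r_neq0 lam0)) -mulrBr normrM.
have lamV0 : 0 < lam^-1 by rewrite invr_gt0.
by rewrite (gtr0_norm lamV0) [leLHS]mulrC ler_pM2r.
Qed.

End row_bijection.

Unset Implicit Arguments.

(* R^k with k = n.+2 >= 2; [alpha 0 0] is the first slope alpha_1. *)
Theorem corollary1p2 (R : realType) (n : nat)
    (V : {vspace 'rV[R]_n.+2}) (alpha : 'rV[R]_n.+1) (x : 'rV[R]_n.+2)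
    (S : set (torus R n.+2)) (I : set (circle R))
    (V_dim : \dim V = n.+1)
    (V_irr : totally_irrational V)
    (V_last : e_last R n.+1 \notin V)
    (V_slopes : slopes V alpha)
    (alpha1_irr : irrational (alpha 0 0))
    (I_special : special_union (fractional_part (alpha 0 0)) I)
    (S_window : S = window I)
    (S_nonempty : S !=set0) :
  exists2 L : set 'rV[R]_n.+2,
    lattice_in V L & BD_equivalent V (cut_and_project V S x) L.
Proof.
have I_nonempty : I !=set0.
  by move: S_nonempty; rewrite S_window => -[_ [t It _]]; exists (\pi_(circle R) t)%qT.
have [lam [C [lam0 brC]]] :=
  special_union_bounded_remainder alpha1_irr I_special I_nonempty.
(* One enumeration for each phase, all with the same [C]. *)
have /choice[G GP] : forall c : R, exists G : int -> int,
    set_bij [set m : int | I (\pi_(circle R) (m%:~R * alpha 0 0 + c))]%qT setT G /\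
    forall m, `|(G m)%:~R - lam * m%:~R| <= C.
  by move=> c; have [G] := bounded_remainder_bij lam0 (brC c); exists G.
have fbij := row_map_bij x V_slopes lam0 (fun c => (GP c).1).
have fbnd := row_map_bounded x I V_slopes lam0 (fun c => (GP c).2).
pose s (i : 'I_n.+1) := if i == 0 then lam^-1 else 1.
have lamV0 : 0 < lam^-1 by rewrite invr_gt0.
have Lsep : separated_net V (slope_lattice alpha s).
  apply: (@slope_lattice_separated _ _ _ _ _ (Num.min lam^-1 1) (Num.max lam^-1 1)) => //.
    by rewrite lt_min lamV0 ltr01.
  by move=> i; rewrite /s; case: eqP => _; rewrite ge_min le_max !lexx ?orbT.
exists (slope_lattice alpha s).
  apply: slope_lattice_lattice_in => // i.
  by rewrite /s; case: ifP => _; rewrite ?oner_eq0 ?gt_eqF.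
rewrite S_window; split=> //; last by exists (row_map alpha x lam G).
(* Relative density of the cut-and-project set is pulled back from the lattice along the
   bijection. *)
have [_ _ Ldense] := Lsep; split.
- by move=> v [].
- exact: cut_and_project_uniformly_discrete V_slopes.
- exact: relatively_dense_bij fbij fbnd Ldense.
Qed.
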